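(* Let $n,m$ be coprime positive integers, let $b,c\in\mathbb{C}\setminus\{0\}$, and let $h(z)=z^{n+m}+b\,\overline{z}^{\,m}+c$, with $\beta=\arg b$ and $\gamma=\arg c$. Suppose that $h$ has two roots $z_1,z_2$ with $|z_1|=|z_2|$. Then $$\frac{(n+m)\beta-(n+2m)\gamma}{\pi}\in\mathbb{Z}\quad\Longleftrightarrow\quad b\in\mathcal{R}(n,m,c).$$ In particular, $(U_j)^c\subseteq\mathcal{R}(n,m,c)$ for each $1\le j\le n+m-1$; that is, if $1\le j\le n+m-1$ and a harmonic trinomial $z^{n+m}+b\,\overline{z}^{\,m}+c$ with $b,c\neq 0$ has $j$-th and $(j+1)$-th smallest roots of equal norm, then $b\in\mathcal{R}(n,m,c)$.
   Context: For coprime positive integers $n,m$ and $c\in\mathbb{C}\setminus\{0\}$ with $\gamma=\arg c$, define the union of rays $$\mathcal{R}(n,m,c)=\bigcup_{k=0}^{2(n+m)-1}\left\{\lambda\, e^{i\frac{(n+2m)\gamma+k\pi}{n+m}}:\ \lambda>0\right\}\subset\mathbb{C}.$$ For a harmonic trinomial $h(z)=z^{n+m}+b\,\overline{z}^{\,m}+c$, list its roots as $z_1,\dots,z_l$ with $|z_1|\le|z_2|\le\cdots\le|z_l|$ (one has $l\le n+3m$). $U_j$ denotes the set of all such harmonic trinomials whose $j$-th and $(j+1)$-th smallest roots in this ordering have distinct norms, and $(U_j)^c$ is its complement, i.e. the set of those with $|z_j|=|z_{j+1}|$. The inclusion $(U_j)^c\subseteq \mathcal{R}(n,m,c)$ is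 understood for fixed $c$, identifying a trinomial with its coefficient $b$. *)

(* Defs.v *)
From HB Require Import structures.
From mathcomp Require Import all_boot all_order all_algebra.
From mathcomp Require Import all_classical all_reals.
From mathcomp Require Import trigo.
From mathcomp Require Import complex.

Set Implicit Arguments.
Unset Strict Implicit.
Unset Printing Implicit Defensive.

Import Order.TTheory GRing.Theory Num.Theory.

Local Open Scope classical_set_scope.
Local Open Scope ring_scope.
Local Open Scope complex_scope.

(* e^{i t}, by Euler's formula *)
Definition cis (R : realType) (t : R) : R[i] := cos t +i* sin t.

(* principal value, in ]-pi, pi]; see cargP *)
Definition carg (R : realType) (z : R[i]) : R :=
  let t := acos (complex.Re z / complex.Re `|z|) in
  if 0 <= complex.Im z then t else - t.

Lemma cargP (R : realType) (z : R[i]) : z != 0 ->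
  - pi < carg z <= pi /\ z = `|z| * cis (carg z).
Proof.
case: z => x y z0; rewrite /carg /cis normc_def /=.
set r := Num.sqrt _.
have s0 : 0 < x ^+ 2 + y ^+ 2.
  rewrite lt_def addr_ge0 ?sqr_ge0// andbT paddr_eq0 ?sqr_ge0//.
  by rewrite !sqrf_eq0; move: z0; rewrite eq_complex.
have r0 : 0 < r by rewrite sqrtr_gt0.
have r2 : r ^+ 2 = x ^+ 2 + y ^+ 2 by rewrite sqr_sqrtr// ltW.
have xr1 : (x / r) ^+ 2 + (y / r) ^+ 2 = 1.
  by rewrite !expr_div_n -mulrDl -r2 divff// sqrf_eq0 gt_eqF.
have xr : -1 <= x / r <= 1.
  by rewrite -ler_norml -(@expr_le1 _ 2) // real_normK ?num_real// -xr1 lerDl sqr_ge0.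
have sa : sin (acos (x / r)) = `|y| / r.
  rewrite sin_acos// -xr1 addrC addKr sqrtr_sqr normrM normfV.
  by rewrite (gtr0_norm r0).
have ca : cos (acos (x / r)) = x / r by rewrite acosK// in_itv.
have rK u : r * (u / r) = u by rewrite mulrC divfK// gt_eqF.
have a0 := acos_ge0 xr.
have api := acos_lepi xr.
case: (leP 0 y) => y0; split.
- by rewrite api andbT (lt_le_trans _ a0)// oppr_lt0 pi_gt0.
- by rewrite ca sa (ger0_norm y0); simpc; rewrite !rK.
- rewrite ltrN2 (le_trans _ (pi_ge0 R)) ?oppr_le0 ?andbT//.
  rewrite lt_neqAle api andbT; apply/eqP => e.
  move: sa; rewrite e sinpi => /esym/eqP.
  by rewrite mulf_eq0 invr_eq0 normr_eq0 (gt_eqF r0) (lt_eqF y0).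
- by rewrite cosN sinN ca sa (ltr0_norm y0) mulNr opprK; simpc; rewrite !rK.
Qed.

Definition trinomial (R : realType) (n m : nat) (b c z : R[i]) : R[i] :=
  z ^+ (n + m) + b * conjc z ^+ m + c.

Definition rays (R : realType) (n m : nat) (c : R[i]) : set R[i] :=
  \bigcup_(k in [set k : nat | (k <= 2 * (n + m) - 1)%N])
    [set lam%:C *
         cis (((n + 2 * m)%:R * carg c + k%:R * pi) / (n + m)%:R)
      | lam in [set lam : R | 0 < lam]].

(* The roots are listed without repetition: a root counted with a
   multiplicity would trivially give two consecutive roots of equal norm. *)
Definition roots_by_norm (R : realType) (n m : nat) (b c : R[i])
    (s : seq R[i]) : Prop :=
  [/\ uniq s,
      forall z, z \in s <-> trinomial n m b c z = 0
    & sorted (fun z w => `|z| <= `|w|) s].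

(* A trinomial with nonzero coefficients is identified with b, for fixed c. *)
Definition trinomials (R : realType) : set R[i] := [set b | b != 0].
Arguments trinomials R : clear implicits.

(* The j-th smallest root (j >= 1) has index j.-1 in the list; its norm does
   not depend on the list s. The complement of U n m c j in trinomials R
   consists of the b <> 0 such that the trinomial has a j-th and a (j+1)-th
   smallest root and these have equal norm. *)
Definition U (R : realType) (n m : nat) (c : R[i]) (j : nat) : set R[i] :=
  [set b | trinomials R b /\
     forall s, roots_by_norm n m b c s -> (j < size s)%N ->
       `|nth 0 s j.-1| != `|nth 0 s j| ].

(* Main.v *)
(* Two roots of equal norm give two triangles with sides z^(n+m), b conj(z)^m
   and c, having the same side lengths and the side c in common. They coincide
   or are mirror images in the line of c. If they coincide, z1 and z2 have the
   same (n+m)-th and m-th powers, so z1 = z2 by coprimality. If they are mirror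
   images, eliminating z1 and z2 from the two equations expressing this shows
   that b^(n+m) conj(c)^(n+2m) is real, i.e. that its argument
   (n+m) arg b - (n+2m) arg c is a multiple of pi. *)

Require Import Defs.
From mathcomp Require Import all_boot all_order all_algebra.
From mathcomp Require Import all_classical all_reals.
From mathcomp Require Import trigo.
From mathcomp Require Import complex.
From mathcomp Require Import ring lra.

Import Order.TTheory GRing.Theory Num.Theory.

Local Open Scope classical_set_scope.
Local Open Scope ring_scope.

Lemma sin_intpi (R : realType) (k : int) : sin (k%:~R * pi : R) = 0.
Proof.
wlog k_ge0 : k / 0 <= k.
  move=> h; case: (leP 0 k) => [|/ltW k0]; first exact: h.
  by rewrite -[k]opprK mulrNz mulNr sinN h ?oppr0 // oppr_ge0.
case: k k_ge0 => // k _; elim: k => [|k IHk]; first by rewrite mul0r sin0.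
by rewrite -addn1 PoszD intrD mulrDl mul1r sinDpi IHk oppr0.
Qed.

Lemma sin_eq0_int (R : realType) (x : R) :
  sin x = 0 <-> x / pi \is a Num.int.
Proof.
have pi0 : pi != 0 :> R by rewrite gt_eqF ?pi_gt0.
split=> [sx0 | /intrP[k xk]]; last first.
  by rewrite -[x](divfK pi0) xk sin_intpi.
(* Removing the whole multiples of [pi] leaves [y] in [[0, pi[], where the sine vanishes only at
   0. *)
set k := Num.floor (x / pi); set y := x - k%:~R * pi.
have y_ge0 : 0 <= y by rewrite subr_ge0 -ler_pdivlMr ?pi_gt0 // floor_le.
have y_ltpi : y < pi.
  rewrite ltrBlDl -[X in _ + X]mul1r -mulrDl -ltr_pdivrMr ?pi_gt0 //.
  by rewrite -(intrD _ k 1) floorD1_gt.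
have sy0 : sin y = 0 by rewrite /y sinB sx0 sin_intpi mul0r mulr0 subrr.
have y0 : y = 0.
  apply/eqP; rewrite eq_le y_ge0 andbT leNgt; apply/negP => y_gt0.
  by have := sin_gt0_pi (introT andP (conj y_gt0 y_ltpi)); rewrite sy0 ltxx.
apply/intrP; exists k; apply: (mulIf pi0); rewrite divfK //.
by apply/eqP; rewrite -subr_eq0 -/y y0.
Qed.

Lemma cisD (R : realType) (x y : R) : cis (x + y) = cis x * cis y.
Proof. by rewrite /cis cosD sinD; simpc; congr (_ +i* _)%C; ring. Qed.

Lemma cis0 (R : realType) : cis 0 = 1 :> R[i].
Proof. by rewrite /cis cos0 sin0. Qed.

Lemma conjc_cis (R : realType) (x : R) : conjc (cis x) = cis (- x).
Proof. by rewrite /cis cosN sinN. Qed.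

Lemma cisX (R : realType) (k : nat) (x : R) : cis x ^+ k = cis (k%:R * x).
Proof.
elim: k => [|k IHk]; first by rewrite mul0r cis0.
by rewrite exprS IHk -cisD -nat1r mulrDl mul1r.
Qed.

Lemma cis_period (R : realType) (k : int) (x : R) :
  cis (x + k%:~R * (2 * pi)) = cis x.
Proof.
(* Since the sine of [k * pi] is 0, its cosine squares to 1, and doubling the angle gives [cis]
   equal to 1. *)
have s0 := @sin_intpi R k; have := cos2Dsin2 (k%:~R * pi : R).
rewrite s0 expr0n addr0 => c1.
rewrite cisD -[RHS]mulr1; congr (_ * _).
rewrite (_ : _ * _ = k%:~R * pi + k%:~R * pi); last by ring.
by rewrite /cis cosD sinD s0 -expr2 c1 !mulr0 mul0r subr0 addr0.
Qed.

Lemma sinB_cis_eq0 (R : realType) (x y : R) : cis x = cis y -> sin (x - y) = 0.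
Proof. by move=> xy; rewrite sinB; case: xy => -> ->; rewrite mulrC subrr. Qed.

(** Adding [2 * (n + m)] to the index of a ray turns it by a full [2 * pi], so an arbitrary integer
    can be replaced by its remainder. Conversely, raising to the power [n + m] clears the
    denominator of the angle. *)
Lemma carg_quantized_rays (R : realType) (n m : nat) (b c : R[i]) :
    (0 < n + m)%N -> b != 0 ->
  ((n + m)%:R * carg b - (n + 2 * m)%:R * carg c) / pi \is a Num.int
    <-> rays n m c b.
Proof.
move=> N_gt0 b0; have [_ bE] := cargP b0.
have N0 : (n + m)%:R != 0 :> R by rewrite pnatr_eq0 -lt0n.
have pi0 : pi != 0 :> R by rewrite gt_eqF ?pi_gt0.
have nbE : (`|b| = (complex.Re `|b|)%:C)%C by rewrite normc_def.
have nb_gt0 : 0 < complex.Re `|b| by move: b0; rewrite -normr_gt0 nbE ltcR.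
split=> [/intrP[k xk] | [k kN [lam lam0 lamE]]].
  have P_gt0 : (0 < 2 * (n + m))%N by rewrite muln_gt0.
  have k0_ge0 : 0 <= (k %% (2 * (n + m))%N%:Z)%Z.
    by rewrite modz_ge0 // eqz_nat -lt0n.
  have k0_lt : ((k %% (2 * (n + m))%N%:Z)%Z < (2 * (n + m))%N%:Z).
    by rewrite ltz_pmod.
  have := divz_eq k (2 * (n + m))%N%:Z.
  move: (_ %/ _)%Z (_ %% _)%Z k0_ge0 k0_lt => q [k0|//] _; rewrite ltz_nat => k0_lt kE.
  exists k0; first by rewrite /= leq_subRL // add1n.
  exists (complex.Re `|b|) => //.
  rewrite [RHS]bE -nbE -(cis_period _ q); congr (_ * cis _).
  apply: (mulfI N0); rewrite mulrDr mulrCA divff // mulr1.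
  have := congr1 (fun z => z * pi) xk; rewrite divfK // kE.
  rewrite intrD intrM -!pmulrn natrM => e; lra.
(* Taking norms identifies the ray parameter, so it can be cancelled to compare unit complex
   numbers. *)
have lamE' : complex.Re `|b| = lam.
  have : `|b| = (lam%:C)%C.
    rewrite -lamE normrM -[X in _ * X](_ : 1 = _) ?mulr1.
      by rewrite normc_def /= expr0n addr0 sqrtr_sqr gtr0_norm.
    by rewrite normc_def /= cos2Dsin2 sqrtr1.
  by move=> ->.
have cE : cis (carg b)
    = cis (((n + 2 * m)%:R * carg c + k%:R * pi) / (n + m)%:R).
  apply: (mulfI (_ : (lam%:C)%C != 0)); first by rewrite eq_complex /= eqxx andbT gt_eqF.
  by rewrite lamE -lamE' -nbE -bE.
have := congr1 (fun z => z ^+ (n + m)) cE.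
rewrite !cisX mulrCA divff // mulr1 => /sinB_cis_eq0 s0.
have /intrP[l lE] := (sin_eq0_int _ _).1 s0.
apply/intrP; exists (l + k); rewrite intrD -lE -pmulrn.
by apply: (mulIf pi0); rewrite [RHS]mulrDl !divfK //; ring.
Qed.

(** In polar form the norms cancel, leaving [cis t = cis (- t)] for [t] the combination of
    arguments; the imaginary parts then give [sin t = 0]. *)
Lemma carg_quantized_real (R : realType) (N M : nat) (b c : R[i]) :
    b != 0 -> c != 0 ->
    b ^+ N * conjc c ^+ M = conjc b ^+ N * c ^+ M ->
  (N%:R * carg b - M%:R * carg c) / pi \is a Num.int.
Proof.
move=> b0 c0; have [_ bE] := cargP b0; have [_ cE] := cargP c0.
have conj_norm (z : R[i]) : conjc `|z| = `|z| by rewrite normc_def /= oppr0.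
rewrite [in LHS]bE [in LHS]cE [in RHS]bE [in RHS]cE.
have conjM (z w : R[i]) : conjc (z * w) = conjc z * conjc w by exact: rmorphM.
rewrite !conjM !conj_norm !exprMn !conjc_cis !cisX !mulrN => e.
apply/sin_eq0_int.
have {e} : cis (N%:R * carg b - M%:R * carg c)
         = cis (- (N%:R * carg b) + M%:R * carg c).
  rewrite !cisD.
  apply: (mulfI (_ : `|b| ^+ N * `|c| ^+ M != 0)).
    by rewrite mulf_neq0 // expf_neq0 // normr_eq0.
  by rewrite mulrACA e mulrACA.
by rewrite [- _ + _]addrC -opprB /cis sinN => -[_] e; lra.
Qed.

(** Bezout in the form [u * n = v * m + 1] keeps all exponents natural; the common factor
    [x ^+ (v * m)] is then cancelled. *)
Lemma expf_coprime_inj (F : fieldType) (n m : nat) (x y : F) :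
    (0 < n)%N -> coprime n m -> x != 0 ->
  x ^+ n = y ^+ n -> x ^+ m = y ^+ m -> x = y.
Proof.
move=> n_gt0 /eqP nm1 x0 xyn xym.
case: (egcdnP m n_gt0) => u v uv _; rewrite nm1 in uv.
apply: (mulfI (expf_neq0 (v * m) x0)).
rewrite -exprSr -addn1 -uv mulnC exprM xyn -exprM mulnC uv.
by rewrite addn1 exprSr mulnC exprM -xym -exprM.
Qed.

Lemma eq_norm_roots_real (R : realType) (n m : nat) (b c z1 z2 : R[i]) :
    (0 < n)%N -> (0 < m)%N -> coprime n m -> b != 0 -> c != 0 ->
    z1 != z2 -> trinomial n m b c z1 = 0 -> trinomial n m b c z2 = 0 ->
    `|z1| = `|z2| ->
  b ^+ (n + m) * conjc c ^+ (n + 2 * m) = conjc b ^+ (n + m) * c ^+ (n + 2 * m).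
Proof.
move=> n_gt0 m_gt0 nm b0 c0 z12 r1 r2 e12.
have zz : z1 * conjc z1 = z2 * conjc z2 by rewrite -!sqr_normc e12.
have z20 : z2 != 0.
  apply: contraNneq c0 => z20; move: r2; rewrite /trinomial z20 conjc0.
  by rewrite !expr0n addn_eq0 !gtn_eqF //= mulr0 !add0r => ->.
have z10 : z1 != 0 by rewrite -normr_eq0 e12 normr_eq0.
have conj_root z : trinomial n m b c z = 0 ->
    conjc z ^+ (n + m) + conjc b * z ^+ m + conjc c = 0.
  move=> /(congr1 (@conjc R)).
  by rewrite /trinomial !rmorphD rmorphM !rmorphXn rmorph0 /= conjcK.
have := conj_root _ r1; have := conj_root _ r2.
move: r1 r2; rewrite /trinomial => r1 r2 r2' r1'.
have NN : z1 ^+ (n + m) * conjc z1 ^+ (n + m)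
        = z2 ^+ (n + m) * conjc z2 ^+ (n + m) by rewrite -!exprMn zz.
have MM : z1 ^+ m * conjc z1 ^+ m = z2 ^+ m * conjc z2 ^+ m.
  by rewrite -!exprMn zz.
have bM (z a z' w : R[i]) : z + a * z' + w = 0 -> a * z' = - (z + w).
  by move/eqP; rewrite addrAC addrC addr_eq0 => /eqP.
(* Same norm and same real part, so [u] is [v] or its conjugate [v']. *)
pose u := z1 ^+ (n + m) * conjc c; pose u' := conjc z1 ^+ (n + m) * c.
pose v := z2 ^+ (n + m) * conjc c; pose v' := conjc z2 ^+ (n + m) * c.
have uv_norm : u * u' = v * v' by rewrite /u /u' /v /v' mulrACA NN mulrACA.
(* Both roots give the same squared norm of [z ^+ (n + m) + c], namely that of [b * conjc z ^+ m].
   In its expansion all terms but the cross terms agree already. *)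
have uv_Re : u + u' = v + v'.
  rewrite /u /u' /v /v'.
  move: r1 r1' r2 r2' NN MM.
  move: (z1 ^+ (n + m)) (z2 ^+ (n + m)) (conjc z1 ^+ (n + m)) => A1 A2 A1'.
  move: (conjc z2 ^+ (n + m)) (z1 ^+ m) (z2 ^+ m) => A2' D1 D2.
  move: (conjc z1 ^+ m) (conjc z2 ^+ m) (conjc b) (conjc c) => D1' D2' b' c'.
  move=> r1 r1' r2 r2' NN MM.
  have : (b * D1') * (b' * D1) = (b * D2') * (b' * D2) by ring: MM.
  rewrite (bM _ _ _ _ r1) (bM _ _ _ _ r1') (bM _ _ _ _ r2) (bM _ _ _ _ r2') => e.
  apply/eqP; rewrite -subr_eq0; apply/eqP.
  transitivity (- (A1 + c) * - (A1' + c') - - (A2 + c) * - (A2' + c')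
                - (A1 * A1' - A2 * A2')); first by ring.
  by rewrite e NN !subrr.
(* [u] is a root of the quadratic with roots [v] and [v'], by equality of sums and products. *)
have : (u - v) * (u - v') = 0.
  transitivity (u * ((u + u') - (v + v')) - (u * u' - v * v')); first by ring.
  by rewrite uv_Re uv_norm !subrr mulr0 subrr.
move/eqP; rewrite mulf_eq0 !subr_eq0 => /orP[] /eqP uv.
  have eN : z1 ^+ (n + m) = z2 ^+ (n + m).
    by apply: (mulIf _ uv); rewrite conjc_eq0.
  have em : z1 ^+ m = z2 ^+ m.
    apply: (inv_inj (@conjcK R)); rewrite !rmorphXn /=; apply: (mulfI b0).
    by rewrite (bM _ _ _ _ r1) (bM _ _ _ _ r2) eN.
  case/eqP: z12; apply: (expf_coprime_inj _ _ _ _ _ n_gt0 nm z10 _ em).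
  by apply: (mulIf (expf_neq0 m z10)); rewrite [in RHS]em -!exprD.
have e1 : conjc z1 ^+ (n + m) * c = z2 ^+ (n + m) * conjc c.
  have := congr1 (@conjc R) uv.
  by rewrite /u /v' !rmorphM !rmorphXn /= !conjcK.
(* By the root equations, the two sides are [- (u + c * conjc c)] and [- (v' + c * conjc c)]. *)
have e2 : b * conjc c * conjc z1 ^+ m = conjc b * c * z2 ^+ m.
  rewrite mulrAC (bM _ _ _ _ r1) (mulrAC (conjc b)) (bM _ _ _ _ r2').
  by rewrite !mulNr !mulrDl -/u -/v' uv (mulrC c).
(* These powers bring [conjc z1] and [z2] to the same exponent [(n + m) * m] in both equations, so
   that both can be eliminated. *)
have e1m := congr1 (fun z => z ^+ m) e1.
have e2N := congr1 (fun z => z ^+ (n + m)) e2.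
rewrite !exprMn -!exprM [(m * _)%N]mulnC in e1m e2N.
apply: (mulIf (expf_neq0 ((n + m) * m) z20)).
rewrite mul2n -addnn addnA !(exprD _ (n + m)).
transitivity (b ^+ (n + m) * conjc c ^+ (n + m)
              * (z2 ^+ ((n + m) * m) * conjc c ^+ m)); first by ring.
by rewrite -e1m [LHS]mulrA e2N; ring.
Qed.

Theorem theorem2p8 (R : realType) (n m : nat) (c : R[i])
    (n_gt0 : (0 < n)%N) (m_gt0 : (0 < m)%N) (nm_coprime : coprime n m)
    (c_neq0 : c != 0) :
  (forall b : R[i], b != 0 ->
     (exists z1 z2 : R[i],
        [/\ z1 != z2, trinomial n m b c z1 = 0, trinomial n m b c z2 = 0
          & `|z1| = `|z2|]) ->
     (((n + m)%:R * carg b - (n + 2 * m)%:R * carg c) / pi \is a Num.int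
        <-> rays n m c b))
  /\
  (forall j : nat, (1 <= j <= n + m - 1)%N ->
     trinomials R `\` U n m c j `<=` rays n m c
     /\
     (forall (b : R[i]) (s : seq R[i]), b != 0 ->
        roots_by_norm n m b c s -> (j < size s)%N ->
        `|nth 0 s j.-1| = `|nth 0 s j| -> rays n m c b)).
Proof.
have N_gt0 : (0 < n + m)%N by rewrite addn_gt0 n_gt0.
split=> [b b0 _ | j /andP[j_gt0 _]]; first exact: carg_quantized_rays.
have eq_rays b s : b != 0 -> roots_by_norm n m b c s -> (j < size s)%N ->
    `|nth 0 s j.-1| = `|nth 0 s j| -> rays n m c b.
  move=> b0 [s_uniq sP _] js e; apply/carg_quantized_rays => //.
  (* Both indices are in range, so each [nth] is a genuine root and not the default 0. *)
  have j1s : (j.-1 < size s)%N by rewrite prednK // ltnW.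
  apply: carg_quantized_real => //.
  apply: (eq_norm_roots_real _ _ _ _ _ _ _ _ _ _ _ _ _ _ _ e) => //; try exact/sP/mem_nth.
  by rewrite nth_uniq // neq_ltn prednK // leqnn.
(* Off the rays, [eq_rays] forbids equal norms in every list of roots, which puts [b] in [U]; no
   list has to be constructed. *)
split=> // b [b0 nUb]; apply: contrapT => nrays; apply: nUb; split=> // s sP js.
by apply/eqP => e; apply: nrays; apply: eq_rays sP js e.
Qed.
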